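(* For every positive integer $n$, $f(n)\leq \lfloor 2n/3\rfloor$; that is, every permutation of $[n]$ can be transformed into the identity permutation $[1\,2\,\cdots\,n]$ using at most $\lfloor 2n/3\rfloor$ cut-and-paste moves.
   Context: Let $[n]=\{1,\ldots,n\}$ and write a permutation of $[n]$ as a string $\pi_1\pi_2\cdots\pi_n$. A cut-and-paste move consists of cutting a (contiguous) substring out of the permutation, optionally reversing it, and then pasting it back into the remaining string at any position. Define $f(n)$ to be the maximum, over all permutations $\pi$ of $[n]$, of the minimum number of cut-and-paste moves needed to transform $\pi$ into the identity permutation $[1\,2\,\cdots\,n]$. *)

(* Defs.v *)
From mathcomp Require Import all_boot all_fingroup.
From mathcomp Require Import boolp.

Set Implicit Arguments.
Unset Strict Implicit.
Unset Printing Implicit Defensive.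

(* The block b is cut out of s = x ++ b ++ y; the remaining string x ++ y is
   split anew as u ++ v, and b or its reversal is pasted in between. An empty
   b is allowed: it gives the trivial move, also obtained by pasting any block
   back where it was. *)
Definition cut_and_paste (T : Type) (s t : seq T) : Prop :=
  exists x b y u v : seq T,
    [/\ s = x ++ b ++ y,
        x ++ y = u ++ v
      & t = u ++ b ++ v \/ t = u ++ rev b ++ v].

Fixpoint transforms_in (T : Type) (k : nat) (s t : seq T) : Prop :=
  if k is k'.+1 then exists2 u, cut_and_paste s u & transforms_in k' u t
  else s = t.

(* 'S_n permutes {0, ..., n-1}; the shift by one gives the string on [n]. *)
Definition perm_string (n : nat) (p : 'S_n) : seq nat :=
  [seq (p i).+1 | i <- enum 'I_n].

Definition id_string (n : nat) : seq nat := iota 1 n.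

Lemma cut_and_paste_cons (T : Type) (a : T) (s t : seq T) :
  cut_and_paste s t -> cut_and_paste (a :: s) (a :: t).
Proof.
move=> [x [b [y [u [v [-> e h]]]]]].
exists (a :: x), b, y, (a :: u), v; split=> //=; first by rewrite e.
by case: h => ->; [left | right].
Qed.

Lemma transforms_in_cons (T : Type) (a : T) k (s t : seq T) :
  transforms_in k s t -> transforms_in k (a :: s) (a :: t).
Proof.
elim: k s => [|k IH] s /=; first by move->.
by case=> u su ut; exists (a :: u); [exact: cut_and_paste_cons | exact: IH].
Qed.

Lemma perm_eq_transforms (T : eqType) (s t : seq T) :
  perm_eq s t -> exists k, transforms_in k s t.
Proof.
elim: t s => [|a t IH] s.
  by move/perm_nilP->; exists 0.
move=> st; have: a \in s by rewrite (perm_mem st) mem_head.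
move=> /splitPr as_; case: as_ st => x y st.
have /IH [k kP] : perm_eq (x ++ y) t.
  by rewrite -(perm_cons a) -(permPr st) perm_sym -cat1s perm_catCA.
exists k.+1, (a :: x ++ y); last exact: transforms_in_cons.
by exists x, [:: a], y, [::], (x ++ y); split=> //; left.
Qed.

Lemma perm_string_sortable (n : nat) (p : 'S_n) :
  exists k, `[< transforms_in k (perm_string p) (id_string n) >].
Proof.
have [|k kP] := @perm_eq_transforms _ (perm_string p) (id_string n).
  apply: uniq_perm.
  - rewrite map_inj_uniq ?enum_uniq // => i j [] /val_inj; exact: perm_inj.
  - exact: iota_uniq.
  move=> m; rewrite mem_iota add1n; apply/mapP/idP.
    by case=> i _ ->; rewrite /= ltnS.
  case: m => // m; rewrite /= ltnS => lt_mn.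
  exists (perm_inv p (Ordinal lt_mn)); first by rewrite mem_enum.
  by rewrite -[perm_inv p]/(p^-1)%g permKV.
by exists k; apply/asboolP.
Qed.

Definition min_moves (n : nat) (p : 'S_n) : nat :=
  ex_minn (perm_string_sortable p).

Definition f (n : nat) : nat := \max_(p : 'S_n) min_moves p.

(* Main.v *)
Require Import Defs.
From mathcomp Require Import all_boot all_fingroup.
From mathcomp Require Import zify.

Set Implicit Arguments.
Unset Strict Implicit.
Unset Printing Implicit Defensive.

(** Cut the string into runs of consecutive values, increasing or decreasing; a
run of length one costs 2 and a longer one costs 3, so that the string costs 2n
when cut into singletons.  It suffices to lower the cost by 3 per move.  Once the
run x with the lowest values stands in front, increasing, it can be discarded;
dually for the highest values at the end.  Let p be the first run.  If x is long,
moving it to the front saves 3.  If x is a singleton, then discarding it saves 2,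
and the move that brings it to the front leaves one more cut free: use it to glue
p to a run whose values are contiguous with those of p, which saves at least 1.
This fails only if p is a singleton and the runs d, e just below and just above
it are both long, lie between p and x and both have the end contiguous with p
turned away from it.  Then two moves discard x and glue d, p and e, which saves 7. *)

(** * Moves inside a longer string *)

Lemma cut_and_paste_cat (T : Type) (x y s t : seq T) :
  cut_and_paste s t -> cut_and_paste (x ++ s ++ y) (x ++ t ++ y).
Proof.
move=> [s1 [b [s2 [u [v [-> e h]]]]]].
exists (x ++ s1), b, (s2 ++ y), (x ++ u), (v ++ y); split.
- by rewrite -!catA.
- by rewrite -!catA (catA s1) e -!catA.
- by case: h => ->; [left | right]; rewrite -!catA.
Qed.

Lemma transforms_in_cat (T : Type) k (x y s t : seq T) :
  transforms_in k s t -> transforms_in k (x ++ s ++ y) (x ++ t ++ y).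
Proof.
elim: k s => [|k IH] s /=; first by move->.
by case=> u su ut; exists (x ++ u ++ y); [exact: cut_and_paste_cat | exact: IH].
Qed.

Lemma transforms_in_trans (T : Type) j k (s t u : seq T) :
  transforms_in j s t -> transforms_in k t u -> transforms_in (j + k) s u.
Proof.
elim: j s => [|j IH] s /=; first by move->.
by case=> v sv vt tu; exists v => //; apply: IH tu.
Qed.

Lemma cut_and_paste_left (T : Type) (x b y z : seq T) :
  cut_and_paste (x ++ y ++ b ++ z) (x ++ b ++ y ++ z).
Proof.
by exists (x ++ y), b, z, x, (y ++ z); split; rewrite -?catA //; left.
Qed.

Lemma cut_and_paste_revl (T : Type) (x b y z : seq T) :
  cut_and_paste (x ++ y ++ b ++ z) (x ++ rev b ++ y ++ z).
Proof.
by exists (x ++ y), b, z, x, (y ++ z); split; rewrite -?catA //; right.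
Qed.

Lemma cut_and_paste_revr (T : Type) (x b y z : seq T) :
  cut_and_paste (x ++ b ++ y ++ z) (x ++ y ++ rev b ++ z).
Proof.
by exists x, b, (y ++ z), (x ++ y), z; split; rewrite -?catA //; right.
Qed.

(** * Runs, their strings and their costs *)

(* The values lo, ..., hi - 1. For hi = lo + 1 the field up is irrelevant. *)
Record run := Run { lo : nat; hi : nat; up : bool }.

Definition flip (u : run) := Run (lo u) (hi u) (~~ up u).
Definition orient (b : bool) (u : run) := Run (lo u) (hi u) b.
Definition str (u : run) : seq nat :=
  if up u then iota (lo u) (hi u - lo u) else rev (iota (lo u) (hi u - lo u)).
Definition single (u : run) := hi u == (lo u).+1.
Definition cost (u : run) := if single u then 2 else 3.

Definition flips (us : seq run) := rev (map flip us).
Definition strs (us : seq run) := flatten (map str us).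
Definition total (us : seq run) := sumn (map cost us).

Arguments strs : simpl never.
Arguments total : simpl never.

(* The intervals are the edges of a path from l to h: every endpoint other
   than l and h is both the top of one run and the bottom of another. *)
Definition balanced (l h : nat) (us : seq run) :=
  all (fun u => lo u < hi u) us && perm_eq (h :: map lo us) (l :: map hi us).

Lemma strs_cat us vs : strs (us ++ vs) = strs us ++ strs vs.
Proof. by rewrite /strs map_cat flatten_cat. Qed.

Lemma strs_cons u us : strs (u :: us) = str u ++ strs us.
Proof. by []. Qed.

Lemma str_flip u : str (flip u) = rev (str u).
Proof. by case: u => a b [] //=; rewrite /str /= revK. Qed.

Lemma strs_flips us : strs (flips us) = rev (strs us).
Proof.
elim: us => // u us IH.
rewrite strs_cons rev_cat -str_flip -IH /flips map_cons rev_cons -cats1 strs_cat.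
by rewrite strs_cons cats0.
Qed.

(** A string of one value equals its reversal, so the flag of a singleton may be chosen freely;
    hence the guard [single u || (up u == b)] where a run has to read in direction [b]. *)
Lemma str_orient b u : single u || (up u == b) -> str (orient b u) = str u.
Proof.
case: u => l h c; rewrite /single /= => /orP [/eqP -> | /eqP -> //].
by rewrite /str /orient /= subSnn; case: c; case: b.
Qed.

Lemma str_orientN b u : single u || (up u != b) -> str (orient b u) = rev (str u).
Proof.
move=> ob; rewrite -str_flip -(@str_orient b (flip u)) //.
by move: ob; rewrite /single /=; case: (up u); case: b.
Qed.

Lemma balancedP l h us :
  balanced l h us <->
  all (fun u => lo u < hi u) us /\
  (forall a : pred nat, a h + count a (map lo us) = a l + count a (map hi us)).
Proof.
split; first by case/andP=> ? /seq.permP.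
by case=> h1 h2; apply/andP; split=> //; apply/seq.permP.
Qed.

Lemma map_lo_flips us : map lo (flips us) = rev (map lo us).
Proof. by rewrite /flips map_rev -map_comp. Qed.

Lemma map_hi_flips us : map hi (flips us) = rev (map hi us).
Proof. by rewrite /flips map_rev -map_comp. Qed.

Lemma all_flips us :
  all (fun u => lo u < hi u) (flips us) = all (fun u => lo u < hi u) us.
Proof. by rewrite /flips all_rev all_map. Qed.

Lemma total_cat us vs : total (us ++ vs) = total us + total vs.
Proof. by rewrite /total map_cat sumn_cat. Qed.

Lemma total_cons u us : total (u :: us) = cost u + total us.
Proof. by []. Qed.

Lemma total_flips us : total (flips us) = total us.
Proof. by rewrite /total /flips map_rev sumn_rev -map_comp. Qed.

Lemma size_flips us : size (flips us) = size us.
Proof. by rewrite /flips size_rev size_map. Qed.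

Lemma cost_le3 u : cost u <= 3.
Proof. by rewrite /cost; case: ifP. Qed.

Lemma cost_ge2 u : 2 <= cost u.
Proof. by rewrite /cost; case: ifP. Qed.

(** * Endpoints of balanced lists *)

Lemma mem_map_split (g : run -> nat) a us :
  a \in map g us -> exists xs u ys, us = xs ++ u :: ys /\ g u = a.
Proof.
elim: us => //= u us IH; rewrite inE => /orP [/eqP -> | /IH [xs [v [ys [-> e]]]]].
  by exists [::], u, us.
by exists (u :: xs), v, ys.
Qed.

Lemma balanced_lo_lt_hi l h us xs u ys :
  balanced l h us -> us = xs ++ u :: ys -> lo u < hi u.
Proof. by case/andP=> al _ e; move: al; rewrite e all_cat /= => /and3P []. Qed.

(** Descent: a lower endpoint other than [l] is the top of some run, whose own lower endpoint is
    smaller. *)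
Lemma balanced_le_lo l h us a : balanced l h us -> a \in map lo us -> l <= a.
Proof.
move=> bal; have [n] := ubnP a; elim: n a => // n IH a lt_an al.
have : a \in h :: map lo us by rewrite inE al orbT.
case/andP: (bal) => _ /perm_mem ->; rewrite inE => /orP [/eqP -> // | ah].
have [xs [u [ys [e ua]]]] := mem_map_split ah.
have lt := balanced_lo_lt_hi bal e; rewrite ua in lt.
apply: leq_trans (ltnW lt).
apply: IH; first by exact: leq_trans lt _.
by rewrite e map_cat mem_cat /= mem_head orbT.
Qed.

Lemma sumn_lo_hi us : all (fun u => lo u < hi u) us ->
  size us + sumn (map lo us) <= sumn (map hi us).
Proof. by elim: us => //= u us IH /andP [h /IH]; lia. Qed.

(** The run lengths sum to [h - l], and each is at least 1. *)
Lemma balanced_le l h us : balanced l h us -> l + size us <= h.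
Proof. by case/andP=> /sumn_lo_hi le /perm_sumn /=; lia. Qed.

Lemma balanced_lowest l h u us : balanced l h (u :: us) -> l \in map lo (u :: us).
Proof.
move=> bal; have /= lt := balanced_le bal.
case/andP: bal => _ /perm_mem /(_ l); rewrite !inE eqxx /= => /orP [/eqP|] //; lia.
Qed.

(* Read in direction b (increasing for true), d is continued by p. *)
Definition meets (b : bool) (d p : run) : Prop :=
  if b then hi d = lo p else lo d = hi p.

(** By balance [lo p], if not [l], is the top of some run, and [hi p], if not [h], is the bottom of
    one; that run is not [p] itself as [lo p < hi p]. *)
Lemma balanced_mate (b : bool) l h p us : balanced l h (p :: us) ->
  (if b then lo p != l else hi p != h) ->
  exists xs d ys, us = xs ++ d :: ys /\ meets b d p.
Proof.
move=> bal; have /= lt := balanced_lo_lt_hi (xs := [::]) bal erefl.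
case/andP: bal => _ /perm_mem pm; case: b => ne.
  move: (pm (lo p)); rewrite !inE eqxx orbT (negPf ne) /= => /esym /orP [/eqP|/mem_map_split //]; lia.
move: (pm (hi p)); rewrite !inE eqxx !orbT (negPf ne) /= => /orP [/eqP|/mem_map_split //]; lia.
Qed.

Definition join (b : bool) (d p : run) : run :=
  if b then Run (lo d) (hi p) true else Run (lo p) (hi d) false.

Lemma str_join b d p : lo d < hi d -> lo p < hi p -> meets b d p ->
  str (join b d p) = str (orient b d) ++ str (orient b p).
Proof.
case: b => /= ltd ltp e; rewrite /str /=.
  by rewrite -e (_ : hi p - lo d = (hi d - lo d) + (hi p - hi d)) ?iotaD; [congr (_ ++ iota _ _)|]; lia.
rewrite -rev_cat e (_ : hi d - lo p = (hi p - lo p) + (hi d - hi p)) ?iotaD; last lia.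
by congr (rev (_ ++ iota _ _)); lia.
Qed.

(** * Reductions that save 3 per move *)

(** The last clause lets runs at either end be discarded: sorting [vs] onto its own interval only
    has to yield a sorting of [us]. For [j = 0] no drop in cost is demanded, so the number of runs
    is the induction measure. *)
Definition reduces (l h : nat) (us : seq run) : Prop :=
  exists j l' h' vs,
    [/\ balanced l' h' vs, size vs < size us, total vs + 3 * j <= total us
      & forall k, transforms_in k (strs vs) (iota l' (h' - l')) ->
                  transforms_in (j + k) (strs us) (iota l (h - l))].

Lemma reduces_by j l' h' vs l h us :
  transforms_in j (strs us) (iota l (l' - l) ++ strs vs ++ iota h' (h - h')) ->
  balanced l' h' vs -> l <= l' -> h' <= h ->
  size vs < size us -> total vs + 3 * j <= total us -> reduces l h us.
Proof.
move=> tr bal ll hh sz tot; exists j, l', h', vs; split=> // k tk.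
have le := balanced_le bal.
apply: transforms_in_trans tr _.
have -> : h - l = (l' - l) + ((h' - l') + (h - h')) by lia.
rewrite !iotaD (_ : l + (l' - l) = l') 1?(_ : l' + (h' - l') = h'); [|lia|lia].
exact: transforms_in_cat.
Qed.

Lemma transforms_in1 (T : Type) (s t s' t' : seq T) :
  cut_and_paste s' t' -> s = s' -> t = t' -> transforms_in 1 s t.
Proof. by move=> ? -> ->; exists t'. Qed.

Definition run_simp :=
  (all_cat, map_cat, count_cat, all_flips, map_lo_flips, map_hi_flips, count_rev,
   size_cat, size_flips, total_cat, total_cons, total_flips).

Ltac run_simpl := do 5! rewrite ?run_simp /=.

(** In counting form, balance is a linear identity: counts and indicators become unknowns for [lia].
    The argument [e] identifies the endpoints that meet; [addn0] is passed as a neutral rewrite when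
    none do. *)
Ltac balance bal e :=
  move/balancedP: bal; do 5! rewrite ?run_simp /=;
  let al := fresh in let cn := fresh in move=> [al cn];
  apply/balancedP; do 5! rewrite ?run_simp /=;
  split; [lia | let a := fresh in move=> a; move: (cn a);
  do 5! rewrite ?run_simp /= ?e;
  repeat match goal with
  | |- context [nat_of_bool ?t] => move: (nat_of_bool t) => ?
  | |- context [count a ?t] => move: (count a t) => ?
  end; lia].

Lemma single_str x : single x -> str x = iota (lo x) (hi x - lo x).
Proof. by move=> sx; rewrite -(@str_orient true x) ?sx. Qed.

Lemma cost_single u : single u -> cost u = 2.
Proof. by rewrite /cost => ->. Qed.

Lemma cost_block u : ~~ single u -> cost u = 3.
Proof. by rewrite /cost => /negPf ->. Qed.

(* p I1 d I2 x K -> x I2' d' p I1 K, where ' is reversal *)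
Lemma reduces_mate_between b l h p I1 d I2 x K :
  let us := p :: I1 ++ d :: I2 ++ x :: K in
  balanced l h us -> lo x = l -> single x -> meets b d p ->
  single p || (up p == b) -> single d || (up d != b) -> reduces l h us.
Proof.
move=> us bal lx sx dp op od.
have ltp := balanced_lo_lt_hi (xs := [::]) bal erefl.
have ltd := balanced_lo_lt_hi (xs := p :: I1) bal erefl.
have ltx : lo x < hi x.
  by apply: (balanced_lo_lt_hi (xs := p :: I1 ++ d :: I2) (ys := K) bal); rewrite /us /= -catA.
apply: (@reduces_by 1 (hi x) h (flips I2 ++ join b d p :: I1 ++ K)) => //.
- apply: transforms_in1 (cut_and_paste_revl [::] (str d ++ strs I2 ++ str x) (str p ++ strs I1) (strs K)) _ _.
    by rewrite /us !(strs_cons, strs_cat) -!catA.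
  rewrite subnn cats0 !(strs_cons, strs_cat) str_join // strs_flips !rev_cat -!catA.
  by rewrite (str_orient op) (str_orientN od) (single_str sx) lx /= -lx (eqP sx) subSnn.
- rewrite /us in bal; subst l; case: b dp {op od} => /= dp; balance bal dp.
- lia.
- rewrite /us; run_simpl; lia.
(* Discarding [x] saves 2, and gluing turns two runs of cost at least 2 into one of cost at most
   3. *)
- rewrite /us; run_simpl; rewrite (cost_single sx); move: (cost_ge2 d) (cost_ge2 p) (cost_le3 (join b d p)); lia.
Qed.

Lemma reduces_head l h p K :
  balanced l h (p :: K) -> lo p = l -> single p || up p -> reduces l h (p :: K).
Proof.
move=> bal lp op.
have ltp := balanced_lo_lt_hi (xs := [::]) bal erefl.
apply: (@reduces_by 0 (hi p) h K) => //.
- rewrite subnn cats0 strs_cons -(@str_orient true p) //; last by case: (up p) op.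
  by rewrite /str /= lp.
- subst l; balance bal addn0.
- lia.
- by run_simpl; lia.
Qed.

Lemma reduces_lowest_block l h I x K :
  balanced l h (I ++ x :: K) -> lo x = l -> ~~ single x -> reduces l h (I ++ x :: K).
Proof.
move=> bal lx bx.
have ltx := balanced_lo_lt_hi bal erefl.
apply: (@reduces_by 1 (hi x) h (I ++ K)) => //.
- case ux: (up x).
    apply: transforms_in1 (cut_and_paste_left [::] (str x) (strs I) (strs K)) _ _.
      by rewrite !(strs_cons, strs_cat).
    by rewrite subnn cats0 strs_cat /= /str ux lx.
  apply: transforms_in1 (cut_and_paste_revl [::] (str x) (strs I) (strs K)) _ _.
    by rewrite !(strs_cons, strs_cat).
  by rewrite subnn cats0 strs_cat /= /str ux lx revK.
- subst l; balance bal addn0.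
- lia.
- by run_simpl; lia.
- run_simpl; rewrite (cost_block bx); lia.
Qed.

(* p I x K1 c K2 -> x K1 c p I K2 *)
Lemma reduces_mate_after b l h p I x K1 c K2 :
  let us := p :: I ++ x :: K1 ++ c :: K2 in
  balanced l h us -> lo x = l -> single x -> meets b c p ->
  single p || (up p == b) -> single c || (up c == b) -> reduces l h us.
Proof.
move=> us bal lx sx cp op oc.
have ltp := balanced_lo_lt_hi (xs := [::]) bal erefl.
have ltx := balanced_lo_lt_hi (xs := p :: I) bal erefl.
have ltc : lo c < hi c.
  by apply: (balanced_lo_lt_hi (xs := p :: I ++ x :: K1) (ys := K2) bal); rewrite /us /= -catA.
apply: (@reduces_by 1 (hi x) h (K1 ++ join b c p :: I ++ K2)) => //.
- apply: transforms_in1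
    (cut_and_paste_left [::] (str x ++ strs K1 ++ str c) (str p ++ strs I) (strs K2)) _ _.
    by rewrite /us !(strs_cons, strs_cat) -!catA.
  rewrite subnn cats0 !(strs_cons, strs_cat) str_join // -!catA.
  by rewrite (str_orient op) (str_orient oc) (single_str sx) lx.
- rewrite /us in bal; subst l; case: b cp {op oc} => /= cp; balance bal cp.
- lia.
- rewrite /us; run_simpl; lia.
- rewrite /us; run_simpl; rewrite (cost_single sx).
  move: (cost_ge2 c) (cost_ge2 p) (cost_le3 (join b c p)); lia.
Qed.

(* p I x K1 c K2 -> x K1 I' p' c K2 *)
Lemma reduces_mate_after_flip b l h p I x K1 c K2 :
  let us := p :: I ++ x :: K1 ++ c :: K2 in
  balanced l h us -> lo x = l -> single x -> meets b c p ->
  single p || (up p == b) -> single c || (up c != b) -> reduces l h us.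
Proof.
move=> us bal lx sx cp op oc.
have ltp := balanced_lo_lt_hi (xs := [::]) bal erefl.
have ltx := balanced_lo_lt_hi (xs := p :: I) bal erefl.
have ltc : lo c < hi c.
  by apply: (balanced_lo_lt_hi (xs := p :: I ++ x :: K1) (ys := K2) bal); rewrite /us /= -catA.
apply: (@reduces_by 1 (hi x) h (K1 ++ flips I ++ flip (join b c p) :: K2)) => //.
- apply: transforms_in1
    (cut_and_paste_revr [::] (str p ++ strs I) (str x ++ strs K1) (str c ++ strs K2)) _ _.
    by rewrite /us !(strs_cons, strs_cat) -!catA.
  rewrite subnn cats0 !(strs_cons, strs_cat) str_flip str_join // strs_flips !rev_cat -!catA.
  by rewrite (str_orient op) (str_orientN oc) revK (single_str sx) lx.
- rewrite /us in bal; subst l; case: b cp {op oc} => /= cp; balance bal cp.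
- lia.
- rewrite /us; run_simpl; lia.
- rewrite /us; run_simpl; rewrite (cost_single sx).
  move: (cost_ge2 c) (cost_ge2 p) (cost_le3 (flip (join b c p))); lia.
Qed.

(* p I x K -> x p I K *)
Lemma reduces_mate_lowest l h p I x K :
  let us := p :: I ++ x :: K in
  balanced l h us -> lo x = l -> single x -> hi x = lo p ->
  single p || up p -> reduces l h us.
Proof.
move=> us bal lx sx xp op.
have ltp := balanced_lo_lt_hi (xs := [::]) bal erefl.
have ltx := balanced_lo_lt_hi (xs := p :: I) bal erefl.
(* The new lower bound is [hi p]: [x] and [p] form a sorted prefix and are both discarded. *)
apply: (@reduces_by 1 (hi p) h (I ++ K)) => //.
- apply: transforms_in1 (cut_and_paste_left [::] (str x) (str p ++ strs I) (strs K)) _ _.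
    by rewrite /us !(strs_cons, strs_cat) -!catA.
  rewrite subnn cats0 strs_cat -(@str_orient true p); last by case: (up p) op.
  rewrite (single_str sx) /str /= -xp lx.
  rewrite (_ : hi p - l = (hi x - l) + (hi p - hi x)); last lia.
  by rewrite iotaD -!catA (_ : l + (hi x - l) = hi x) //; lia.
- rewrite /us in bal; subst l; balance bal xp.
- lia.
- rewrite /us; run_simpl; lia.
- rewrite /us; run_simpl; move: (cost_ge2 x) (cost_ge2 p); lia.
Qed.

(* p I x K -> x K I' p' *)
Lemma reduces_highest l h p I x K :
  let us := p :: I ++ x :: K in
  balanced l h us -> lo x = l -> single x -> hi p = h ->
  single p || ~~ up p -> reduces l h us.
Proof.
move=> us bal lx sx ph op.
have ltp := balanced_lo_lt_hi (xs := [::]) bal erefl.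
have ltx := balanced_lo_lt_hi (xs := p :: I) bal erefl.
(* Both ends shrink: [x] leaves at the front, and the reversed [p], now increasing with the highest
   values, leaves at the end. *)
apply: (@reduces_by 1 (hi x) (lo p) (K ++ flips I)) => //.
- apply: transforms_in1
    (cut_and_paste_revr [::] (str p ++ strs I) (str x ++ strs K) [::]) _ _.
    by rewrite /us !(strs_cons, strs_cat) -!catA cats0.
  rewrite strs_cat strs_flips rev_cat cats0 -(@str_orientN true p); last by case: (up p) op.
  by rewrite (single_str sx) /str /= ph lx -!catA.
- rewrite /us in bal; subst l h; balance bal addn0.
- lia.
- lia.
- rewrite /us; run_simpl; lia.
- rewrite /us; run_simpl; move: (cost_ge2 x) (cost_ge2 p); lia.
Qed.

(** Gluing two long runs saves 3 by itself, so the move can ignore the lowest run: [d] is pasted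
    before [p], reversed if its direction is wrong. *)
Lemma reduces_blocks b l h p I d K :
  let us := p :: I ++ d :: K in
  balanced l h us -> meets b d p ->
  ~~ single p -> ~~ single d -> up p = b -> reduces l h us.
Proof.
move=> us bal dp bp bd upb.
have ltp := balanced_lo_lt_hi (xs := [::]) bal erefl.
have ltd := balanced_lo_lt_hi (xs := p :: I) bal erefl.
have op : single p || (up p == b) by rewrite upb eqxx orbT.
apply: (@reduces_by 1 l h (join b d p :: I ++ K)) => //.
- rewrite !subnn cats0 strs_cons str_join // (str_orient op) strs_cat.
  case: (eqVneq (up d) b) => ud.
    apply: transforms_in1 (cut_and_paste_left [::] (str d) (str p ++ strs I) (strs K)) _ _.
      by rewrite /us !(strs_cons, strs_cat) -!catA.
    by rewrite str_orient ?ud ?eqxx ?orbT //= -!catA.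
  apply: transforms_in1 (cut_and_paste_revl [::] (str d) (str p ++ strs I) (strs K)) _ _.
    by rewrite /us !(strs_cons, strs_cat) -!catA.
  by rewrite str_orientN ?ud ?orbT //= -!catA.
- rewrite /us in bal; case: b dp {op upb} => /= dp; balance bal dp.
- rewrite /us; run_simpl; lia.
- rewrite /us; run_simpl; rewrite (cost_block bp) (cost_block bd).
  move: (cost_le3 (join b d p)); lia.
Qed.

(* p U d V e W x K -> p e' V' d' U W x K -> x W' U' d p e' V' K *)
Lemma reduces_two_mates b l h p U d V e W x K :
  let us := p :: U ++ d :: V ++ e :: W ++ x :: K in
  balanced l h us -> lo x = l -> single x -> single p ->
  meets b d p -> meets (~~ b) e p -> ~~ single d -> ~~ single e ->
  up d = b -> up e = ~~ b -> reduces l h us.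
Proof.
move=> us bal lx sx sp dp ep bd be ud ue.
have ltp := balanced_lo_lt_hi (xs := [::]) bal erefl.
have ltd := balanced_lo_lt_hi (xs := p :: U) bal erefl.
have lte : lo e < hi e.
  by apply: (balanced_lo_lt_hi (xs := p :: U ++ d :: V) bal); rewrite /us /= -catA.
have ltx : lo x < hi x.
  by apply: (balanced_lo_lt_hi (xs := p :: U ++ d :: V ++ e :: W) (ys := K) bal);
     rewrite /us /= -!catA /= -!catA.
have od : single d || (up d == b) by rewrite ud eqxx orbT.
have oe : single e || (up e != b) by rewrite ue; case: (b); rewrite orbT.
(* As [e] has direction [~~ b], its reversal continues [join b d p] in direction [b]. *)
have strm : str (join b (join b d p) e) = str d ++ str p ++ rev (str e).
  rewrite str_join //; try by case: b dp ep {ud ue od oe} => /= dp ep; lia.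
  rewrite (str_orientN oe) catA; congr (_ ++ _).
  rewrite -{1}(str_orient od) -(@str_orient b p) ?sp // -str_join //.
  by rewrite str_orient //; case: (b); rewrite ?orbT.
apply: (@reduces_by 2 (hi x) h
  (flips W ++ flips U ++ join b (join b d p) e :: flips V ++ K)) => //.
- exists (str p ++ rev (str d ++ strs V ++ str e) ++ strs U ++ strs W ++ str x ++ strs K).
    have := cut_and_paste_revl (str p) (str d ++ strs V ++ str e) (strs U)
      (strs W ++ str x ++ strs K).
    by rewrite /us !(strs_cons, strs_cat) -!catA.
  apply: transforms_in1 (cut_and_paste_revl [::] (rev (str d) ++ strs U ++ strs W ++ str x)
    (str p ++ rev (str e) ++ rev (strs V)) (strs K)) _ _.
    by rewrite !rev_cat -!catA.
  rewrite subnn cats0 !(strs_cons, strs_cat) strm !strs_flips !rev_cat revK -!catA.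
  by rewrite (single_str sx) lx (eqP sx) lx subSnn.
- rewrite /us in bal; subst l.
  case: b dp ep {ud ue od oe strm} => /= dp ep; balance bal (dp, ep).
- lia.
- rewrite /us; run_simpl; lia.
- rewrite /us; run_simpl; rewrite (cost_single sx) (cost_single sp) (cost_block bd) (cost_block be).
  move: (cost_le3 (join b (join b d p) e)); lia.
Qed.

(** * Positions of the mates *)

(** Decides whether a mate stands after, at or before [x], and later which of two mates comes
    first. *)
Lemma cat_cons_split (T : Type) (s t u v : seq T) (a c : T) :
  s ++ a :: t = u ++ c :: v ->
  [\/ exists2 w, u = s ++ a :: w & t = w ++ c :: v,
      [/\ u = s, c = a & v = t] |
      exists2 w, s = u ++ c :: w & v = w ++ a :: t].
Proof.
elim: s u => [|y s IH] [|z u] /= [].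
- by move=> -> ->; constructor 2.
- by move=> -> ->; constructor 1; exists u.
- by move=> -> <-; constructor 3; exists s.
by move=> -> /IH [[w -> ->]|[-> -> ->]|[w -> ->]];
  [constructor 1; exists w | constructor 2 | constructor 3; exists w].
Qed.

(** A mate beyond [x] can be glued whichever way it points. A mate between [p] and [x] is reversed
    by the move, so it resists only if it is long and already points in direction [b]. *)
Lemma reduces_or_mate_between b l h p I x K :
  let us := p :: I ++ x :: K in
  balanced l h us -> lo x = l -> single x -> single p || (up p == b) ->
  (if b then lo p != l else hi p != h) ->
  reduces l h us \/
  exists I1 d I2, [/\ I = I1 ++ d :: I2, meets b d p, single p, ~~ single d & up d = b].
Proof.
move=> us bal lx sx op ne.
have [xs [d [ys [e dp]]]] := balanced_mate bal ne.
(* Two long mates are glued at once; afterwards [p] or [d] is a singleton. *)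
have [/andP [bp bd]|sdp] := boolP (~~ single p && ~~ single d).
  left; move: bal; rewrite /us e => bal; rewrite (negPf bp) /= in op.
  exact: reduces_blocks bal dp bp bd (eqP op).
case: (cat_cons_split e) => [[K1 _ eK] | [_ dx _] | [I2 eI _]].
- left; move: bal; rewrite /us eK => bal.
  case: (boolP (single d || (up d == b))) => od.
    exact: reduces_mate_after bal lx sx dp op od.
  apply: reduces_mate_after_flip bal lx sx dp op _.
  by move: od; rewrite negb_or orbC => /andP [_ ->].
- left; move: dp op ne; rewrite dx; case: b => dp op _.
    by apply: reduces_mate_lowest bal lx sx dp _; rewrite eqb_id in op.
  (* In the decreasing direction the mate cannot be [x]: [hi p = l] would contradict [l <= lo p]. *)
  have := balanced_le_lo bal (mem_head _ _).
  have := balanced_lo_lt_hi (xs := [::]) bal erefl; move: dp; rewrite /=; lia.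
- case: (boolP (single d || (up d != b))) => od.
    left; move: bal; rewrite /us eI -catA => bal.
    exact: reduces_mate_between bal lx sx dp op od.
  right; exists xs, d, I2; move: od; rewrite negb_or negbK => /andP [bd /eqP ud].
  by split=> //; move: sdp; rewrite bd andbT negbK.
Qed.

Lemma balanced_reduces l h p us : balanced l h (p :: us) -> reduces l h (p :: us).
Proof.
move=> bal.
have [lp|nlp] := eqVneq (lo p) l.
  have [op|] := boolP (single p || up p); first exact: reduces_head.
  by rewrite negb_or => /andP [bp _]; apply: (@reduces_lowest_block _ _ [::]).
have : l \in map lo us by move: (balanced_lowest bal); rewrite inE eq_sym (negPf nlp).
case/mem_map_split=> I [x [K [e lx]]]; subst us.
have [sx|bx] := boolP (single x); last exact: (@reduces_lowest_block _ _ (p :: I)).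
(* Direction [false] needs a run just above [p]; if [hi p = h], then [p] is discarded at the end
   instead. *)
have down : single p || (up p == false) ->
    reduces l h (p :: I ++ x :: K) \/
    exists J1 e J2, [/\ I = J1 ++ e :: J2, meets false e p, single p, ~~ single e & up e = false].
  move=> op; have [hp|nhp] := eqVneq (hi p) h.
    by left; apply: reduces_highest bal lx sx hp _; rewrite eqbF_neg in op.
  exact: reduces_or_mate_between bal lx sx op nhp.
(* A long decreasing [p] admits only direction [false], where an obstruction would force it to be a
   singleton. *)
have [op|] := boolP (single p || (up p == true)); last first.
  rewrite negb_or => /andP [bp up_p]; case: down => //.
    by rewrite eqb_id in up_p; rewrite (negPf up_p) orbT.
  by case=> J1 [e [J2 []]]; rewrite (negPf bp).
case: (reduces_or_mate_between bal lx sx op nlp) => // -[I1 [d [I2 [eI dp sp bd ud]]]].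
case: down => [|//|[J1 [e [J2 [eJ ep _ be ue]]]]]; first by rewrite sp.
(* Both mates obstruct. They point in opposite directions, hence differ; their order selects the
   direction of the two-move reduction. *)
have es : J1 ++ e :: J2 = I1 ++ d :: I2 by rewrite -eJ.
case: (cat_cons_split es) => [[w e1 e2] | [_ de _] | [w e1 e2]].
- move: bal; rewrite eJ e2 -?catA /= -?catA /= -?catA => bal.
  exact: (@reduces_two_mates false) bal lx sx sp ep dp be bd ue ud.
- by move: ud; rewrite de ue.
- move: bal; rewrite eJ e1 -?catA /= -?catA /= -?catA => bal.
  exact: (@reduces_two_mates true) bal lx sx sp dp ep bd be ud ue.
Qed.

(** * From runs to the bound *)

Lemma balanced_sortable l h us : balanced l h us ->
  exists2 k, 3 * k <= total us & transforms_in k (strs us) (iota l (h - l)).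
Proof.
have [n] := ubnP (size us); elim: n l h us => // n IH l h [|p us] ltn bal.
  exists 0 => //=; case/andP: bal => _ /perm_mem /(_ l).
  by rewrite !inE eqxx => /eqP ->; rewrite subnn.
have [j [l' [h' [vs [bal' sz tot tr]]]]] := balanced_reduces bal.
have [|k le_k /tr tk] := IH l' h' vs _ bal'; first exact: leq_trans sz ltn.
by exists (j + k) => //; lia.
Qed.

Lemma perm_iota_sortable n s : perm_eq s (iota 1 n) ->
  exists2 k, k <= (2 * n) %/ 3 & transforms_in k s (iota 1 n).
Proof.
move=> ps; pose us := [seq Run v v.+1 true | v <- s].
have [] := @balanced_sortable 1 n.+1 us.
  rewrite /balanced all_map; apply/andP; split; first by apply/allP => v _ /=.
  (* Both endpoint lists are rearrangements of [1, ..., n.+1]. *)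
  rewrite -!map_comp map_id (perm_trans (y := n.+1 :: iota 1 n)) ?perm_cons //.
  rewrite perm_sym (perm_trans (y := 1 :: iota 2 n)) //.
    by rewrite perm_cons (iotaDl 1 1) perm_map.
  by rewrite -[1 :: _]/(iota 1 n.+1) -(addn1 n) iotaD cats1 perm_rcons addnC.
have -> : total us = 2 * n.
  rewrite -(size_iota 1 n) -(perm_size ps) /us.
  by elim: (s) => //= v t IHt; rewrite total_cons IHt cost_single /single //=; lia.
have -> : strs us = s.
  by rewrite /us; elim: (s) => //= v t IHt; rewrite strs_cons IHt /str /= subSnn.
by rewrite subSS subn0 => k le_k tr; exists k => //; rewrite leq_divRL // mulnC.
Qed.

Lemma perm_string_perm_eq (n : nat) (p : 'S_n) : perm_eq (perm_string p) (iota 1 n).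
Proof.
apply: uniq_perm; rewrite ?iota_uniq //.
  by rewrite map_inj_uniq ?enum_uniq // => i j [] /val_inj; exact: perm_inj.
move=> m; rewrite mem_iota add1n; apply/mapP/idP.
  by case=> i _ ->; rewrite /= ltnS.
case: m => // m; rewrite /= ltnS => lt_mn.
by exists ((p^-1)%g (Ordinal lt_mn)); rewrite ?mem_enum ?permKV.
Qed.

Theorem mainTheorem2 (n : nat) (hn : 0 < n) :
  f n <= (2 * n) %/ 3 /\
  (forall p : 'S_n, exists2 k : nat, k <= (2 * n) %/ 3 &
     transforms_in k (perm_string p) (id_string n)).
Proof.
have sortable (p : 'S_n) := perm_iota_sortable (perm_string_perm_eq p).
split=> //; apply/bigmax_leqP => p _.
have [k le_k tr] := sortable p.
rewrite /min_moves; case: ex_minnP => m _ min_m.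
by apply: leq_trans le_k; apply: min_m; apply/boolp.asboolP.
Qed.
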